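(* Let $T_n$ be a tree with $n$ vertices. Then $$\frac{\sqrt{2}(n-3)}{2}+\sqrt{5}\leq BSO(T_n)\leq \sqrt{1+(n-1)^2}.$$ The equality in the left-hand side holds if and only if $T_n\cong P_n$, and the equality in the right-hand side holds if and only if $T_n\cong K_{1,n-1}$.
   Context: Graphs are simple, undirected and connected. For a connected graph $G$ with edge set $E(G)$, $d_v$ denotes the degree of the vertex $v$ in $G$, and the first Banhatti-Sombor index of $G$ is $BSO(G)=\sum_{uv\in E(G)}\sqrt{\frac{1}{d_u^2}+\frac{1}{d_v^2}}$. $P_n$ and $K_{1,n-1}$ denote the path and the star with $n$ vertices, respectively.
   Formalization: The lower bound and its equality case are stated for n ≥ 3 (they fail for n = 1, 2, e.g. BSO(K_2) = √2 < √5 − √2/2), and the equality case of the upper bound for n ≥ 2 (it fails for n = 1, where BSO = 0 < 1). *)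

(* Defs.v *)
From HB Require Import structures.
From mathcomp Require Import all_boot all_order all_algebra.

Set Implicit Arguments.
Unset Strict Implicit.
Unset Printing Implicit Defensive.

Import Order.TTheory GRing.Theory Num.Theory.
Local Open Scope ring_scope.

Record sgraph := SGraph {
  vertex :> finType;
  adj : rel vertex;
  adj_sym : symmetric adj;
  adj_irrefl : irreflexive adj }.

Section Graphs.
Variable G : sgraph.

Definition degree (v : G) : nat := #|[set w : G | adj v w]|.

Definition edges : {set {set G}} := [set [set x; y] | x in G, y in G & adj x y].

Definition connected_graph : Prop :=
  (0 < #|G|)%N /\ (forall x y : G, connect (@adj G) x y).

(* The bound on the size is needed: for any edge xy, the sequence [:: x; y]
   is a duplicate-free cycle of the symmetric relation adj. *)
Definition acyclic_graph : Prop :=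
  forall c : seq G, (2 < size c)%N -> uniq c -> ~~ cycle (@adj G) c.

Definition is_tree : Prop := connected_graph /\ acyclic_graph.

(* An edge E = {u, v} is a two-element set, so the inner sum is
   1/d_u^2 + 1/d_v^2; see BSO_termE. *)
Definition BSO (R : rcfType) : R :=
  \sum_(E in edges) Num.sqrt (\sum_(v in E) 1 / (degree v)%:R ^+ 2).

Lemma BSO_termE (R : rcfType) (u v : G) : adj u v ->
  Num.sqrt (\sum_(w in [set u; v]) 1 / (degree w)%:R ^+ 2) =
  Num.sqrt (1 / (degree u)%:R ^+ 2 + 1 / (degree v)%:R ^+ 2) :> R.
Proof.
move=> uv; rewrite big_setU1 ?big_set1 //= inE.
by apply: contraTneq uv => ->; rewrite adj_irrefl.
Qed.

End Graphs.

Definition graph_iso (G H : sgraph) : Prop :=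
  exists2 f : G -> H, bijective f & forall x y, adj (f x) (f y) = adj x y.

Section PathGraph.
Variable n : nat.

Definition path_adj : rel 'I_n :=
  fun i j => (i.+1 == j :> nat) || (j.+1 == i :> nat).

Lemma path_adj_sym : symmetric path_adj.
Proof. by move=> i j; rewrite /path_adj orbC. Qed.

Lemma path_adj_irrefl : irreflexive path_adj.
Proof. by move=> i; rewrite /path_adj orbb gtn_eqF. Qed.

Definition path_graph : sgraph := SGraph path_adj_sym path_adj_irrefl.

End PathGraph.

Section CompleteBipartite.
Variables m n : nat.

Definition bipartite_adj : rel ('I_m + 'I_n)%type :=
  fun x y => match x, y with
             | inl _, inr _ | inr _, inl _ => true
             | _, _ => false
             end.

Lemma bipartite_adj_sym : symmetric bipartite_adj.
Proof. by case=> [x|x] [y|y]. Qed.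

Lemma bipartite_adj_irrefl : irreflexive bipartite_adj.
Proof. by case. Qed.

Definition complete_bipartite : sgraph :=
  SGraph bipartite_adj_sym bipartite_adj_irrefl.

End CompleteBipartite.

Definition star_graph (n : nat) : sgraph := complete_bipartite 1 n.-1.

(* Main.v *)
Require Import Defs.
From HB Require Import structures.
From mathcomp Require Import all_boot all_order all_algebra.
From mathcomp Require Import zify ring lra.

Set Implicit Arguments.
Unset Strict Implicit.
Unset Printing Implicit Defensive.

Import Order.TTheory GRing.Theory Num.Theory.
Local Open Scope ring_scope.

(** Why the bounds hold.  Both come from replacing the edge term
    sqrt (1/a^2 + 1/b^2), where a and b are the degrees of the ends, by a sum
    w a + w b of vertex weights.  By double counting ([handshake]), the sum of
    w a + w b over the edges is the sum of d w(d) over the vertices, which is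
    easy to evaluate; in particular 1/a + 1/b sums to n.

    Lower bound.  The comparison of the arithmetic and quadratic means gives
    sqrt (1/a^2 + 1/b^2) >= (1/a + 1/b) / sqrt 2, hence BSO >= n / sqrt 2.
    This is strict on a pendant edge, where the ends have degrees 1 and b >= 2;
    the excess there is smallest for b = 2, where it equals
    g = sqrt 5 / 2 - 3 sqrt 2 / 4.  With w a = 1 / (a sqrt 2), plus g if a = 1,
    the bound becomes n / sqrt 2 + g * (number of leaves)
    ([lower_edge_leif], [BSO_lower_leif]).  A tree has at least two leaves, the
    ends of a longest path ([acyclic_two_leaves]), and n / sqrt 2 + 2 g is the
    claimed bound.  In the equality case every edge has degrees (a, a) or
    (1, 2), so all degrees are at most 2 by connectedness, and then a longest
    path exhausts the tree ([tree_path_iso]).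

    Upper bound.  The identity
      1/a + 1/b - sqrt (1/a^2 + 1/b^2) = 2 / (a + b + sqrt (a^2 + b^2))
    expresses how far an edge term falls short of 1/a + 1/b.  A tree has no
    triangle, so a + b <= n ([acyclic_degreeD]); moreover ab >= a + b - 1, so
    a^2 + b^2 <= 1 + (n-1)^2.  Every edge therefore loses at least
    q = 2 / (n + sqrt (1 + (n-1)^2)), and there are at least n - 1 edges
    ([connected_card_edges]), so BSO <= n - (n-1) q = sqrt (1 + (n-1)^2)
    ([upper_edge_leif], [BSO_upper_leif]).  Equality forces the degrees of every
    edge to be 1 and n - 1, so some vertex is adjacent to all the others
    ([acyclic_star_iso]).

    Comparisons are stated with conditional equality, x <= y ?= iff C, so that
    the equality cases follow from the same computations as the bounds. *)

(** * Counting over the edges *)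
Section Edges.
Variable G : sgraph.
Implicit Types (u v w x y : G) (E : {set G}).

Lemma edgesP E :
  reflect (exists u v, adj u v /\ E = [set u; v]) (E \in edges G).
Proof.
apply: (iffP imset2P) => [[u v _ + ->]|[u [v [uv ->]]]].
  by rewrite inE => /andP[_ uv]; exists u, v.
by exists u v; rewrite ?inE.
Qed.

Lemma adj_neq u v : adj u v -> u != v.
Proof. by apply: contraTneq => ->; rewrite adj_irrefl. Qed.

Lemma big_edge (V : nmodType) (h : G -> V) u v : adj u v ->
  \sum_(w in [set u; v]) h w = h u + h v.
Proof. by move=> uv; rewrite big_setU1 ?big_set1 // inE adj_neq. Qed.

(** The edges through v correspond to the neighbours w of v by w |-> {v, w}. *)
Lemma card_edges_at v : #|[set E in edges G | v \in E]| = degree v.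
Proof.
rewrite /degree -[RHS](@card_in_imset _ _ (fun w => [set v; w])).
  apply: eq_card => E; rewrite inE; apply/andP/imsetP.
    case=> /edgesP[x [y [xy ->]]]; rewrite !inE => /orP[]/eqP->.
      by exists y; rewrite ?inE.
    by exists x; rewrite ?inE 1?adj_sym // setUC.
  case=> w; rewrite inE => vw ->; split; last by rewrite set21.
  by apply/edgesP; exists v, w.
move=> x y; rewrite !inE => vx vy /setP/(_ x).
by rewrite set22 !inE eq_sym (negPf (adj_neq vx)) => /esym/eqP.
Qed.

(** Double counting of the pairs of an edge and one of its ends: v occurs in
    [degree v] edges. *)
Lemma handshake (V : nmodType) (h : G -> V) :
  \sum_(E in edges G) \sum_(v in E) h v = \sum_v h v *+ degree v.
Proof.
rewrite (exchange_big_dep predT) //=; apply: eq_bigr => v _.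
rewrite sumr_const -card_edges_at; congr (_ *+ _).
by apply: eq_card => E; rewrite [in RHS]inE.
Qed.

Lemma sum_degree : (\sum_(v : G) degree v = 2 * #|edges G|)%N.
Proof.
under eq_bigr do rewrite -[degree _]natn.
rewrite -(handshake (fun=> 1 : nat)) -sum1_card big_distrr /=.
apply: eq_bigr => _ /edgesP[u [v [uv ->]]].
by rewrite big_edge.
Qed.

(** Transfers an inequality between edge terms, with its equality case, to the
    sums over the edges; the equality case then constrains every edge. *)
Lemma edge_sum_leif (R : numDomainType) (F F' : {set G} -> R) (C : rel G) :
    (forall u v, adj u v -> F [set u; v] <= F' [set u; v] ?= iff C u v) ->
  \sum_(E in edges G) F E <= \sum_(E in edges G) F' E
    ?= iff [forall u, forall v, adj u v ==> C u v].
Proof.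
move=> le_FF'.
have leE E : E \in edges G -> F E <= F' E ?= iff (F E == F' E).
  case/edgesP=> u [v [/le_FF' le_uv ->]]; split=> //; exact: le_uv.1.
suff -> : [forall u, forall v, adj u v ==> C u v] =
          [forall (E | E \in edges G), F E == F' E].
  exact: leif_sum leE.
apply/'forall_'forall_implyP/'forall_implyP => [eqC E|eqF u v uv].
  by case/edgesP=> u [v [uv ->]]; rewrite (le_FF' _ _ uv).2 eqC.
rewrite -(le_FF' _ _ uv).2; apply: eqF; apply/edgesP; by exists u, v.
Qed.

End Edges.

(** * Connected graphs *)
Section Connected.
Variable G : sgraph.
Hypothesis connG : connected_graph G.
Implicit Types (u v w x y : G) (S : {set G}).

(** The form in which connectedness is used: a property that holds at one vertex
    and spreads along edges holds everywhere. *)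
Lemma connected_closed S x :
  x \in S -> (forall u v, u \in S -> adj u v -> v \in S) -> S = setT.
Proof.
move=> xS clS; apply/setP => y; rewrite inE.
have /connectP[p] := connG.2 x y.
elim: p x xS => /= [x xS _ -> //|z p IHp x xS /andP[xz]].
by apply: IHp; apply: clS xz.
Qed.

Lemma connected_cut S x : x \in S -> S != setT ->
  exists u v, [/\ u \in S, v \notin S & adj u v].
Proof.
move=> xS nST; apply/'exists_'exists_and3P; apply: contraNT nST => noE.
apply/eqP/(connected_closed xS) => u v uS uv; apply: contraNT noE => vS.
by apply/'exists_'exists_and3P; exists u, v.
Qed.

Lemma degree_gt0 v : (1 < #|G|)%N -> (0 < degree v)%N.
Proof.
move=> G_gt1; have [||u [w [/set1P-> _ vw]]] := @connected_cut [set v] v.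
- exact: set11.
- by apply: contraTneq G_gt1 => eqT; rewrite -cardsT -eqT cards1.
by apply/card_gt0P; exists w; rewrite inE.
Qed.

Lemma degree1_adj u v w : degree u = 1%N -> adj u v -> adj u w -> w = v.
Proof.
move/eqP/cards1P=> [z Nu] uv uw; have := Nu; move/setP => Nz.
by have := Nz v; have := Nz w; rewrite !inE uv uw => /esym/eqP-> /esym/eqP->.
Qed.

(** If both ends of an edge had degree 1, the edge would be a whole connected
    component, hence the whole graph. *)
Lemma edge_degrees_gt2 u v : (2 < #|G|)%N -> adj u v ->
  (2 < degree u + degree v)%N.
Proof.
move=> G_gt2 uv; have d_gt0 w := degree_gt0 w (ltnW G_gt2).
rewrite ltnNge; apply: contraL G_gt2 => le2.
have [du dv] : degree u = 1%N /\ degree v = 1%N.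
  by have := d_gt0 u; have := d_gt0 v; lia.
rewrite -leqNgt -cardsT -(@connected_closed [set u; v] u) ?set21 //.
  by rewrite cards2 adj_neq.
move=> x y; rewrite !inE => /orP[]/eqP-> xy.
  by rewrite (degree1_adj du uv xy) eqxx orbT.
by rewrite (degree1_adj dv (v := u) _ xy) ?eqxx // adj_sym.
Qed.

(** Grow a set from one vertex: as long as it is not everything, some edge leaves
    it, and adding the outer end of that edge adds at least one inner edge. *)
Lemma connected_card_edges : (#|G|.-1 <= #|edges G|)%N.
Proof.
pose inside S := [set E in edges G | E \subset S].
suff grow k : (k < #|G|)%N -> exists2 S : {set G}, #|S| = k.+1 & (k <= #|inside S|)%N.
  have /grow[S _ le_in] : (#|G|.-1 < #|G|)%N.
    by rewrite prednK // connG.1.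
  apply: leq_trans le_in _; apply/subset_leq_card/subsetP => E.
  by rewrite inE => /andP[].
elim: k => [|k IHk] ltkG.
  by have /card_gt0P[x _] := ltkG; exists [set x]; rewrite ?cards1.
have [S cardS le_k] := IHk (ltnW ltkG).
have /card_gt0P[x xS] : (0 < #|S|)%N by rewrite cardS.
have [|u [v [uS vS uv]]] := connected_cut xS.
  by apply: contraTneq ltkG => eqT; rewrite -cardsT -eqT cardS ltnn.
exists (v |: S); first by rewrite cardsU1 vS cardS.
apply: leq_trans (_ : #|[set u; v] |: inside S| <= _)%N.
  by rewrite cardsU1 inE subUset !sub1set (negPf vS) !andbF.
apply/subset_leq_card/subsetP => E; rewrite !inE => /orP[/eqP->|/andP[-> /=]].
  apply/andP; split; first by apply/edgesP; exists u, v.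
  by rewrite subUset !sub1set !inE uS eqxx orbT.
by move/subset_trans; apply; apply: subsetUr.
Qed.

End Connected.

(** * Acyclic graphs *)
Section Acyclic.
Variable G : sgraph.
Hypothesis acycG : acyclic_graph G.
Implicit Types (u v w x y : G) (p q : seq G).

Lemma acyclic_triangle_free u v w : adj u v -> adj v w -> ~~ adj w u.
Proof.
move=> uv vw; apply: contraTN isT => wu.
have := acycG (c := [:: u; v; w]) isT; rewrite /= !inE uv vw wu /= => -> //.
by rewrite negb_or (adj_neq uv) (adj_neq vw) eq_sym (adj_neq wu).
Qed.

(** The neighbourhoods of adjacent vertices are disjoint, as a common neighbour
    would close a triangle. *)
Lemma acyclic_degreeD u v : adj u v -> (degree u + degree v <= #|G|)%N.
Proof.
move=> uv.
have disj : [set w | adj u w] :&: [set w | adj v w] = set0.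
  apply/setP => w; rewrite !inE; apply: contraTF uv => /andP[uw vw].
  by rewrite adj_sym; apply: acyclic_triangle_free uw _; rewrite adj_sym.
by rewrite -cardsUI disj cards0 addn0 max_card.
Qed.

(** The segment of p from i to j, together with a chord, would be a cycle; its
    length is at least 3 because i and j are not consecutive. *)
Lemma acyclic_chordless x0 p i j : sorted (@adj G) p -> uniq p ->
  (i.+1 < j < size p)%N -> ~~ adj (nth x0 p j) (nth x0 p i).
Proof.
move=> sp up /andP[ltij ltj].
set c := drop i (take j.+1 p).
have sz : size c = (j.+1 - i)%N by rewrite size_drop size_takel.
have nth_c k : (i + k <= j)%N -> nth x0 c k = nth x0 p (i + k).
  by move=> le_kj; rewrite nth_drop nth_take.
have := acycG (c := c); rewrite sz drop_uniq ?take_uniq //.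
have : sorted (@adj G) c by apply/drop_sorted/take_sorted.
have <- : nth x0 c (size c).-1 = nth x0 p j
  by rewrite sz nth_c; [congr (nth _ _ _)|]; lia.
have <- : nth x0 c 0 = nth x0 p i by rewrite nth_c addn0 //; lia.
rewrite nth_last; case: c sz {nth_c} => [|y c] /=; first lia.
by move=> _ pc; rewrite rcons_path pc => -> //; lia.
Qed.

End Acyclic.

(** * Longest paths *)

(** Of maximum length among all paths, not merely non-extendable. *)
Definition longest_path (G : sgraph) (p : seq G) :=
  [/\ sorted (@adj G) p, uniq p
    & forall q : seq G, sorted (@adj G) q -> uniq q -> (size q <= size p)%N].

Section LongestPath.
Variable G : sgraph.
Implicit Types (u v w x y : G) (p q : seq G).

Lemma longest_path_exists : exists p : seq G, longest_path p.
Proof.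
pose P k := [exists t : k.-tuple G, sorted (@adj G) t && uniq t].
have P0 : exists k, P k by exists 0%N; apply/existsP; exists [tuple].
have Pmax k : P k -> (k <= #|G|)%N.
  by case/existsP=> t /andP[_ /card_uniqP]; rewrite size_tuple => <-; apply: max_card.
have [k /existsP[t /andP[st ut]] max_k] := ex_maxnP P0 Pmax.
exists t; split=> // q sq uq; rewrite size_tuple; apply: max_k.
by apply/existsP; exists (in_tuple q); rewrite sq.
Qed.

Lemma longest_path_rev p : longest_path p -> longest_path (rev p).
Proof.
case=> sp up maxp; split; rewrite ?rev_uniq ?size_rev //.
by rewrite rev_sorted (eq_sorted (e' := @adj G)) // => x y; rewrite adj_sym.
Qed.

(** Otherwise y could be put in front of the path. *)
Lemma longest_path_head x p y : longest_path (x :: p) -> adj x y -> y \in x :: p.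
Proof.
case=> sp up maxp xy; apply: contraT => ynp.
by have := maxp (y :: x :: p); rewrite /= ltnn adj_sym xy ynp => /(_ sp up).
Qed.

Lemma longest_path_size p : connected_graph G -> (1 < #|G|)%N ->
  longest_path p -> (1 < size p)%N.
Proof.
move=> connG G_gt1 [_ _ maxp]; have /card_gt0P[x _] := ltnW G_gt1.
have /card_gt0P[y] := degree_gt0 connG x G_gt1; rewrite inE => xy.
by apply: (maxp [:: x; y]); rewrite /= ?xy ?inE ?adj_neq.
Qed.

Hypothesis acycG : acyclic_graph G.

(** All neighbours of x are on the path by maximality, and one beyond y would give
    a chord. *)
Lemma longest_path_head_leaf x y p :
  longest_path [:: x, y & p] -> degree x = 1%N.
Proof.
move=> maxp; have [sp up _] := maxp; have /andP[xy _] := sp.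
apply/eqP/cards1P; exists y; apply/setP => z; rewrite !inE.
apply/idP/eqP => [xz|-> //].
have /(nthP x)[[|[|i]] lti eqz] := longest_path_head maxp xz => //.
  by rewrite -eqz /= adj_irrefl in xz.
have := acyclic_chordless acycG x (i := 0) (j := i.+2) sp up lti.
by rewrite eqz adj_sym xz.
Qed.

(** The two ends of a longest path are leaves; reversing the path turns the last
    vertex into the first one. *)
Lemma acyclic_two_leaves : connected_graph G -> (1 < #|G|)%N ->
  (1 < #|[set v : G | degree v == 1%N]|)%N.
Proof.
move=> connG G_gt1; have [p maxp] := longest_path_exists.
have := longest_path_size connG G_gt1 maxp.
have := longest_path_rev maxp; move: maxp.
case: p => [|x [|y p]] //; case/lastP: p => [|p z].
  move=> /= maxp maxr _; apply/card_gt1P; exists x, y.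
  rewrite !inE (longest_path_head_leaf maxp) (longest_path_head_leaf maxr).
  by split=> //; have [/= /andP[/adj_neq]] := maxp.
move=> maxp; rewrite -!rcons_cons rev_rcons; case Er: rev => [|t r].
  by move/(congr1 size): Er; rewrite size_rev.
move=> maxr _; apply/card_gt1P; exists x, z.
rewrite !inE (longest_path_head_leaf maxp) (longest_path_head_leaf maxr).
split=> //; case: maxp => _ /= /andP[+ _] _.
by rewrite !inE mem_rcons inE !negb_or => /and3P[].
Qed.

(** An inner vertex already has its two neighbours on the path, and the ends
    cannot have a neighbour outside by maximality. *)
Lemma longest_path_closed p u v : (forall w, degree w <= 2)%N ->
  longest_path p -> u \in p -> adj u v -> v \in p.
Proof.
move=> le2 maxp up uv; case/splitPr: up maxp => p1 p2.
case/lastP: p1 => [|p1 x] maxp; first exact: longest_path_head maxp uv.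
case: p2 maxp => [|y p2] maxp.
  have := longest_path_rev maxp; rewrite -mem_rev cats1 rev_rcons.
  by move=> /longest_path_head; apply.
have [+ + _] := maxp; rewrite cat_rcons => /cat_sorted2[_ /and3P[xu uy _]].
rewrite cat_uniq /= !inE !negb_or => /and3P[_ _ /andP[/and3P[_ xy _] _]].
have Nu : [set x; y] = [set w | adj u w].
  apply/eqP; rewrite eqEcard cards2 xy subUset !sub1set !inE uy adj_sym xu /=.
  exact: le2.
have : v \in [set x; y] by rewrite Nu inE.
by rewrite !inE mem_cat !inE => /orP[] ->; rewrite !orbT.
Qed.

(** A longest path contains every vertex, since it is closed under adjacency; as
    it has no chord, the position on the path is an isomorphism. *)
Lemma tree_path_iso : connected_graph G -> (1 < #|G|)%N ->
  (forall v, degree v <= 2)%N -> graph_iso G (path_graph #|G|).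
Proof.
move=> connG G_gt1 le2; have [p maxp] := longest_path_exists.
have [sp up _] := maxp.
have p_full x : x \in p.
  have [y yp] : exists y, y \in p.
    have := longest_path_size connG G_gt1 maxp.
    by case: (p) => // y q _; exists y; apply: mem_head.
  suff : [set z in p] = setT by move/setP/(_ x); rewrite !inE.
  apply: (connected_closed connG (x := y)); rewrite ?inE // => u v.
  by rewrite !inE; apply: longest_path_closed.
have size_p : size p = #|G|.
  by rewrite -(card_uniqP up); apply: eq_card => x; rewrite p_full.
have lt_index x : (index x p < #|G|)%N by rewrite -size_p index_mem.
exists (fun x => Ordinal (lt_index x) : path_graph #|G|).
  apply: inj_card_bij; last by rewrite card_ord.
  by move=> x y [] /(congr1 (nth x p)); rewrite !nth_index.
have path_adjE x y : (index x p).+1 = index y p -> adj x y.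
  move=> eq_xy; rewrite -[x](nth_index x (p_full x)).
  rewrite -[y](nth_index x (p_full y)) -eq_xy.
  by apply: (sortedP x sp); rewrite eq_xy index_mem.
have chord x y : ((index x p).+1 < index y p)%N -> ~~ adj x y.
  move=> lt_xy; have := acyclic_chordless acycG x sp up (i := index x p).
  move=> /(_ (index y p)); rewrite !nth_index // lt_xy index_mem p_full.
  by rewrite adj_sym; apply.
move=> x y; rewrite /= /path_adj /=; apply/orP/idP => [[]/eqP|xy].
- exact: path_adjE.
- by rewrite adj_sym; apply: path_adjE.
case: (ltngtP (index x p) (index y p)) => [lt_xy|lt_yx|eq_xy].
- by left; rewrite eqn_leq lt_xy leqNgt; apply: contraTN xy; apply: chord.
- right; rewrite eqn_leq lt_yx leqNgt; apply: contraTN xy.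
  by rewrite adj_sym; apply: chord.
- by have /adj_neq/eqP[] := xy; move/(congr1 (nth x p)): eq_xy; rewrite !nth_index.
Qed.

End LongestPath.

(** * The path and the star *)
Section Models.

Lemma iso_degree (G H : sgraph) (f : G -> H) x :
    bijective f -> (forall x y, adj (f x) (f y) = adj x y) ->
  degree (f x) = degree x.
Proof.
move=> bij_f adj_f; have [g fK gK] := bij_f.
rewrite /degree -(card_imset _ (bij_inj bij_f)).
apply: eq_card => y; rewrite !inE -[y]gK adj_f.
by rewrite (mem_imset _ _ (bij_inj bij_f)) inE.
Qed.

Lemma path_graph_degree m (i : path_graph m.+2) :
  degree i = if (i == ord0) || (i == ord_max) then 1%N else 2%N.
Proof.
have [->|i_neq0] := eqVneq i ord0.
  apply/eqP/cards1P; exists (inord 1); apply/setP => j.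
  by rewrite !inE -val_eqE /= /path_adj inordK //= eq_sym orbF.
have [->|i_neqm] := eqVneq i ord_max.
  apply/eqP/cards1P; exists (inord m); apply/setP => j.
  rewrite !inE -val_eqE /= /path_adj inordK //= eqSS.
  by rewrite [_ == j :> nat]gtn_eqF.
have i_gt0 : (0 < i)%N by rewrite lt0n.
have i_ltm : (i.+1 < m.+2)%N.
  by rewrite ltnS ltn_neqAle i_neqm -ltnS ltn_ord.
have -> : degree i = #|[set inord i.-1; inord i.+1 : 'I_m.+2]|.
  apply: eq_card => j; rewrite !inE -!val_eqE /= /path_adj.
  by rewrite !inordK //; lia.
by rewrite cards2 -val_eqE /= !inordK //; lia.
Qed.

Lemma star_degree_center n (i : 'I_1) : degree (inl i : star_graph n) = n.-1.
Proof.
rewrite -[RHS]card_ord -(card_imset _ (@inr_inj 'I_1 _)).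
by apply: eq_card => -[j|j]; rewrite inE /=; apply/esym/imsetP;
  [case | exists j].
Qed.

Lemma star_degree_leaf n (j : 'I_n.-1) : degree (inr j : star_graph n) = 1%N.
Proof.
rewrite -[RHS](card_ord 1) -(card_imset _ (@inl_inj _ 'I_n.-1)).
by apply: eq_card => -[i|i]; rewrite inE /=; apply/esym/imsetP;
  [exists i | case].
Qed.

(** The center v is adjacent to every other vertex, so an edge between two other
    vertices would close a triangle. *)
Lemma acyclic_star_iso (G : sgraph) (v : G) : acyclic_graph G ->
  degree v = #|G|.-1 -> graph_iso G (star_graph #|G|).
Proof.
move=> acycG dv; have Nv x : x != v -> adj v x.
  have : [set w | adj v w] = [set~ v].
    apply/eqP; rewrite eqEcard cardsC1 -dv leqnn andbT.
    by apply/subsetP => w; rewrite !inE eq_sym; apply: adj_neq.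
  by move/setP/(_ x); rewrite !inE => ->.
pose s := enum [set~ v].
have size_s : size s = #|G|.-1 by rewrite -cardE cardsC1.
have s_v x : (x \in s) = (x != v) by rewrite mem_enum !inE.
(* The list s omits v, so the index of v in s is out of range and [insub] sends
   v, and only v, to the center. *)
pose f x : star_graph #|G| :=
  if insub (index x s) is Some i then inr i else inl ord0.
have fv : f v = inl ord0.
  by rewrite /f insubN // -size_s -leqNgt leqNgt index_mem s_v eqxx.
have fN x : x != v -> exists2 i, f x = inr i & i = index x s :> nat.
  rewrite -s_v -index_mem size_s /f => lt_x.
  by rewrite insubT; exists (Sub (index x s) lt_x).
exists f.
  apply: inj_card_bij.
    move=> x y; have [->|xv] := eqVneq x v; have [->|yv] := eqVneq y v => //.
    - by have [i ->] := fN y yv; rewrite fv.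
    - by have [i ->] := fN x xv; rewrite fv.
    have [i -> iE] := fN x xv; have [j -> jE] := fN y yv; case=> eq_ij.
    have: index x s = index y s by rewrite -iE -jE eq_ij.
    by move/(congr1 (nth x s)); rewrite !nth_index ?s_v.
  rewrite card_sum !card_ord add1n prednK //.
  by apply/card_gt0P; exists v.
move=> x y; have [->|xv] := eqVneq x v; have [->|yv] := eqVneq y v => //.
- by rewrite fv !adj_irrefl.
- by have [i ->] := fN y yv; rewrite fv Nv.
- by have [i -> _] := fN x xv; rewrite fv [RHS]adj_sym Nv.
have [i -> _] := fN x xv; have [j -> _] := fN y yv; apply/esym/negbTE.
apply: (acyclic_triangle_free acycG (v := v)); last exact: Nv.
by rewrite adj_sym Nv.
Qed.

End Models.

(** * Inequalities for one edge *)
Section Inequalities.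
Variable R : rcfType.
Implicit Types (x y z : R) (a b n : nat) (C : bool).

Lemma leif_diff x y z C : y - x = z -> 0 <= z -> (z == 0) = C ->
  x <= y ?= iff C.
Proof. by move=> <- ge0 <-; split; [rewrite -subr_ge0 | rewrite subr_eq0 eq_sym]. Qed.

(** The difference of the two sides, multiplied by their sum, is (x - y)^2 / 2. *)
Lemma quadratic_mean_leif x y : 0 < x -> 0 <= y ->
  Num.sqrt 2 / 2 * (x + y) <= Num.sqrt (x ^+ 2 + y ^+ 2) ?= iff (x == y).
Proof.
move=> x_gt0 y_ge0; set c := Num.sqrt 2; set S := Num.sqrt _.
have c2 : c ^+ 2 = 2 by rewrite sqr_sqrtr.
have S2 : S ^+ 2 = x ^+ 2 + y ^+ 2 by rewrite sqr_sqrtr ?addr_ge0 ?sqr_ge0.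
have c_gt0 : 0 < c by rewrite sqrtr_gt0.
have S_ge0 : 0 <= S by apply: sqrtr_ge0.
have D_gt0 : 0 < S + c / 2 * (x + y) by rewrite ltr_wpDl // mulr_gt0 ?divr_gt0 ?ltr_wpDr.
apply: (@leif_diff _ _ ((x - y) ^+ 2 / 2 / (S + c / 2 * (x + y)))).
- apply: (canRL (mulfK (lt0r_neq0 D_gt0))).
  by rewrite -subr_sqr exprMn expr_div_n c2 S2; field.
- by rewrite !divr_ge0 ?sqr_ge0 // ltW.
- rewrite !mulf_eq0 !invr_eq0 (gt_eqF D_gt0) pnatr_eq0 !orbF orbb.
  by rewrite subr_eq0.
Qed.

(** With x the inverse degree of the inner end of a pendant edge, this bounds its
    term by the value at x = 1/2 and the slope 1 / sqrt 2.  The difference of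
    the sides is the product of 1/2 - x with
    1 / sqrt 2 - (1/2 + x) / (sqrt 5 / 2 + sqrt (1 + x^2)), and the latter is
    positive because both roots in the denominator are at least 1 while
    1/2 + x <= 1. *)
Lemma pendant_leif x : 0 <= x <= 1 / 2 ->
  Num.sqrt 2 / 2 * (1 + x) + (Num.sqrt 5 / 2 - 3 * Num.sqrt 2 / 4)
    <= Num.sqrt (1 + x ^+ 2) ?= iff (x == 1 / 2).
Proof.
move=> /andP[x_ge0 x_le]; set c := Num.sqrt 2; set A := Num.sqrt 5.
set S := Num.sqrt _.
have c2 : c ^+ 2 = 2 by rewrite sqr_sqrtr.
have A2 : A ^+ 2 = 5 by rewrite sqr_sqrtr.
have S2 : S ^+ 2 = 1 + x ^+ 2 by rewrite sqr_sqrtr ?addr_ge0 ?sqr_ge0.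
have c_ge0 : 0 <= c by apply: sqrtr_ge0.
have A_ge0 : 0 <= A by apply: sqrtr_ge0.
have S_ge0 : 0 <= S by apply: sqrtr_ge0.
have c_gt1 : 1 < c by nra.
have A_gt2 : 2 < A by nra.
have S_ge1 : 1 <= S by nra.
have slope_gt0 : 0 < c / 2 * (A / 2 + S) - (1 / 2 + x) by nra.
have D_gt0 : 0 < A / 2 + S by lra.
apply: (@leif_diff _ _
  ((1 / 2 - x) * ((c / 2 * (A / 2 + S) - (1 / 2 + x)) / (A / 2 + S)))).
- apply: (mulIf (lt0r_neq0 D_gt0)).
  rewrite -[RHS]mulrA divfK ?lt0r_neq0 //.
  apply/eqP; rewrite -subr_eq0; apply/eqP.
  transitivity (S ^+ 2 - A ^+ 2 / 4 - (x ^+ 2 - 1 / 4)); first by field.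
  by rewrite S2 A2; field.
- by rewrite mulr_ge0 ?subr_ge0 // divr_ge0 // ltW.
- rewrite !mulf_eq0 invr_eq0 (gt_eqF slope_gt0) (gt_eqF D_gt0) !orbF.
  by rewrite subr_eq0 eq_sym.
Qed.

(** The second summand is the share of a leaf: the excess, on an edge with degrees
    1 and 2, of the edge term over (1 + 1/2) / sqrt 2. *)
Definition lower_weight a : R :=
  Num.sqrt 2 / 2 * (1 / a%:R)
    + (a == 1%N)%:R * (Num.sqrt 5 / 2 - 3 * Num.sqrt 2 / 4).

Lemma leaf_bonus_gt0 : 0 < Num.sqrt 5 / 2 - 3 * Num.sqrt 2 / 4 :> R.
Proof.
have c2 : Num.sqrt 2 ^+ 2 = 2 :> R by rewrite sqr_sqrtr.
have A2 : Num.sqrt 5 ^+ 2 = 5 :> R by rewrite sqr_sqrtr.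
have c_ge0 : 0 <= Num.sqrt 2 :> R by apply: sqrtr_ge0.
have A_ge0 : 0 <= Num.sqrt 5 :> R by apply: sqrtr_ge0.
nra.
Qed.

Lemma lower_edge_leif a b : (0 < a)%N -> (0 < b)%N -> (2 < a + b)%N ->
  lower_weight a + lower_weight b
    <= Num.sqrt (1 / a%:R ^+ 2 + 1 / b%:R ^+ 2)
    ?= iff ((a == b) || (a + b == 3)%N).
Proof.
wlog le_ab : a b / (a <= b)%N => [IH|].
  have [/IH//|/ltnW le_ba a_gt0 b_gt0 gt2] := leqP a b.
  rewrite addrC [1 / a%:R ^+ 2 + _]addrC eq_sym [(a + b)%N]addnC.
  by apply: IH => //; rewrite addnC.
move=> a_gt0 b_gt0 gt2; rewrite /lower_weight.
have sqrV d : 1 / d%:R ^+ 2 = (1 / d%:R) ^+ 2 :> R by rewrite expr_div_n expr1n.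
have b_neq1 : (b == 1)%N = false by lia.
rewrite b_neq1 mul0r addr0 !sqrV.
have bR : 2 <= b%:R :> R by rewrite ler_nat; lia.
have [->|a_neq1] := eqVneq a 1%N.
  rewrite divr1 expr1n [true%:R * _]mul1r addrAC -mulrDr.
  have -> : (1%N == b) || (1 + b == 3)%N = (1 / b%:R == 1 / 2 :> R).
    by rewrite !div1r (inj_eq invr_inj) eqr_nat; lia.
  apply: pendant_leif; rewrite divr_ge0 ?ler0n //=.
  by rewrite ler_pdivrMr ?ler_pdivlMr; lra.
rewrite mul0r addr0 -mulrDr.
have -> : (a == b) || (a + b == 3)%N = (1 / a%:R == 1 / b%:R :> R).
  by rewrite !div1r (inj_eq invr_inj) eqr_nat; lia.
by apply: quadratic_mean_leif; rewrite ?divr_gt0 ?divr_ge0 ?ltr0n ?ler0n.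
Qed.

(** The value of 1/a + 1/b - sqrt (1/a^2 + 1/b^2) at a = 1, b = n - 1, that is,
    on an edge of the star, written with the root in the denominator. *)
Definition upper_defect n : R :=
  2 / (n%:R + Num.sqrt (1 + (n%:R - 1) ^+ 2)).

Definition upper_weight n a : R := 1 / a%:R - upper_defect n / 2.

(** The difference of the radicands is 2 (a - 1) (b - 1): for a given sum, the
    squares are largest when one of the numbers is 1. *)
Lemma sqr_sum_leif a b : (0 < a)%N -> (0 < b)%N ->
  Num.sqrt (a%:R ^+ 2 + b%:R ^+ 2)
    <= Num.sqrt (1 + ((a + b)%:R - 1) ^+ 2)
    ?= iff ((a == 1) || (b == 1))%N :> R.
Proof.
move=> a_gt0 b_gt0.
have aR : 1 <= a%:R :> R by rewrite ler1n.
have bR : 1 <= b%:R :> R by rewrite ler1n.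
have S_ge0 : 0 <= a%:R ^+ 2 + b%:R ^+ 2 :> R by rewrite addr_ge0 ?sqr_ge0.
have M_ge0 : 0 <= 1 + ((a + b)%:R - 1) ^+ 2 :> R by rewrite addr_ge0 ?sqr_ge0.
suff [leSM eqSM] : a%:R ^+ 2 + b%:R ^+ 2 <= 1 + ((a + b)%:R - 1) ^+ 2
    ?= iff ((a == 1) || (b == 1))%N :> R.
  by split; rewrite ?ler_sqrt // eqr_sqrt.
apply: (@leif_diff _ _ (2 * ((a%:R - 1) * (b%:R - 1)))).
- by rewrite natrD; ring.
- by rewrite !mulr_ge0 ?subr_ge0.
- by rewrite !mulf_eq0 pnatr_eq0 /= !subr_eq0 !pnatr_eq1.
Qed.

(** Both sides are 1/a + 1/b minus a fraction with numerator 2, so it suffices to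
    compare the denominators a + b + sqrt (a^2 + b^2) and
    n + sqrt (1 + (n - 1)^2). *)
Lemma upper_edge_leif n a b : (0 < a)%N -> (0 < b)%N -> (a + b <= n)%N ->
  Num.sqrt (1 / a%:R ^+ 2 + 1 / b%:R ^+ 2)
    <= upper_weight n a + upper_weight n b
    ?= iff ((a + b == n) && ((a == 1) || (b == 1)))%N.
Proof.
move=> a_gt0 b_gt0 le_n; rewrite /upper_weight /upper_defect.
have aR : 0 < a%:R :> R by rewrite ltr0n.
have bR : 0 < b%:R :> R by rewrite ltr0n.
set M := Num.sqrt (1 + (n%:R - 1) ^+ 2).
pose S : R := Num.sqrt (a%:R ^+ 2 + b%:R ^+ 2).
have S2 : S ^+ 2 = a%:R ^+ 2 + b%:R ^+ 2 by rewrite sqr_sqrtr ?addr_ge0 ?sqr_ge0.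
have S_ge0 : 0 <= S by apply: sqrtr_ge0.
have M_ge0 : 0 <= M by apply: sqrtr_ge0.
have -> : Num.sqrt (1 / a%:R ^+ 2 + 1 / b%:R ^+ 2) = S / (a%:R * b%:R) :> R.
  apply/eqP; rewrite -(@eqrXn2 _ 2) ?sqrtr_ge0 ?divr_ge0 ?mulr_ge0 ?ler0n //.
  rewrite sqr_sqrtr ?addr_ge0 ?divr_ge0 ?sqr_ge0 //.
  rewrite expr_div_n S2; by apply/eqP; field; rewrite !lt0r_neq0.
have leifD : a%:R + b%:R + S <= n%:R + M
    ?= iff ((a + b == n) && ((a == 1) || (b == 1)))%N.
  rewrite andbC; apply: (leif_trans (x2 := a%:R + b%:R
      + Num.sqrt (1 + ((a + b)%:R - 1) ^+ 2))).
    by rewrite (mono_leif (lerD2l _)); apply: sqr_sum_leif.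
  rewrite -natrD /M; set k := (a + b)%N; have k_gt0 : (0 < k)%N by lia.
  have [<-|k_neqn] := eqVneq k n; first by split; rewrite ?lexx ?eqxx.
  have lt_kn : (k%:R < n%:R :> R) by rewrite ltr_nat ltn_neqAle k_neqn.
  have kR : 1 <= k%:R :> R by rewrite ler1n.
  suff lt_kM : k%:R + Num.sqrt (1 + (k%:R - 1) ^+ 2)
      < n%:R + Num.sqrt (1 + (n%:R - 1) ^+ 2) :> R.
    by split; [apply: ltW | apply: lt_eqF].
  apply: ltr_leD => //; by rewrite ler_sqrt ?addr_ge0 ?sqr_ge0 // lerD2l; nra.
have q_gt0 : 0 < a%:R + b%:R + S by lra.
have p_gt0 : 0 < n%:R + M by apply: lt_le_trans q_gt0 leifD.1.
apply: (@leif_diff _ _ (2 * ((n%:R + M) - (a%:R + b%:R + S))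
   / ((n%:R + M) * (a%:R + b%:R + S)))).
- have defect : 1 / a%:R + 1 / b%:R - S / (a%:R * b%:R)
      = 2 / (a%:R + b%:R + S).
    apply: (canRL (mulfK (lt0r_neq0 q_gt0))).
    transitivity (((a%:R + b%:R) ^+ 2 - S ^+ 2) / (a%:R * b%:R)).
      by field; rewrite !lt0r_neq0.
    by rewrite S2; field; rewrite !lt0r_neq0.
  transitivity (2 / (a%:R + b%:R + S) - 2 / (n%:R + M)).
    by rewrite -defect; field; rewrite !lt0r_neq0.
  by field; rewrite !lt0r_neq0.
- by rewrite divr_ge0 ?mulr_ge0 ?subr_ge0 ?leifD.1 // ltW.
- rewrite !mulf_eq0 invr_eq0 !mulf_eq0 !(gt_eqF q_gt0) !(gt_eqF p_gt0).
  by rewrite pnatr_eq0 /= !orbF subr_eq0 eq_sym leifD.2.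
Qed.

Lemma upper_defect_gt0 n : (0 < n)%N -> 0 < upper_defect n.
Proof.
by move=> n_gt0; rewrite divr_gt0 // ltr_wpDr ?sqrtr_ge0 ?ltr0n.
Qed.

(** Rationalize the defect: n^2 - (1 + (n - 1)^2) = 2 (n - 1). *)
Lemma upper_defectE n : (0 < n)%N ->
  n%:R - n.-1%:R * upper_defect n = Num.sqrt (1 + (n%:R - 1) ^+ 2).
Proof.
case: n => // n _; rewrite /upper_defect /=; set M := Num.sqrt _.
have M2 : M ^+ 2 = 1 + (n.+1%:R - 1) ^+ 2 by rewrite sqr_sqrtr ?addr_ge0 ?sqr_ge0.
have D_gt0 : 0 < n.+1%:R + M by rewrite ltr_wpDr ?sqrtr_ge0.
apply: (mulIf (lt0r_neq0 D_gt0)).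
rewrite mulrBl mulrA divfK ?lt0r_neq0 //.
apply/eqP; rewrite -subr_eq0; apply/eqP.
transitivity (n.+1%:R ^+ 2 - 2 * n%:R - M ^+ 2); first by ring.
by rewrite M2 -natr1; ring.
Qed.

End Inequalities.

(** * The bounds for trees *)
Section TreeBounds.
Variables (R : rcfType) (T : sgraph).
Hypothesis treeT : is_tree T.

Let leaves := [set v : T | degree v == 1%N].

(** The weights sum to n / sqrt 2 + g * (number of leaves), so the bound is lost
    exactly by having more than two leaves or by a strict edge inequality. *)
Lemma BSO_lower_leif : (2 < #|T|)%N ->
  Num.sqrt 2 * (#|T|%:R - 3) / 2 + Num.sqrt 5 <= BSO T R
    ?= iff ((#|leaves| == 2) &&
      [forall u : T, forall v : T, adj u v ==>
        (degree u == degree v) || (degree u + degree v == 3)%N]).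
Proof.
move=> T_gt2; have [connT acycT] := treeT.
have d_gt0 (v : T) : (0 < degree v)%N by exact: degree_gt0 connT v (ltnW T_gt2).
apply: (leif_trans (x2 :=
    \sum_(E in edges T) \sum_(v in E) lower_weight R (degree v))).
  rewrite handshake.
  have termE (v : T) : lower_weight R (degree v) *+ degree v = Num.sqrt 2 / 2
      + (degree v == 1%N)%:R * (Num.sqrt 5 / 2 - 3 * Num.sqrt 2 / 4).
    have dR : (degree v)%:R != 0 :> R by rewrite pnatr_eq0 -lt0n.
    rewrite /lower_weight -mulr_natr.
    by have [->|_] := eqVneq (degree v) 1%N; rewrite /= ?mulr1n ?mulr0n; field.
  have -> : \sum_(v : T) lower_weight R (degree v) *+ degree v =
      Num.sqrt 2 / 2 * #|T|%:R
        + #|leaves|%:R * (Num.sqrt 5 / 2 - 3 * Num.sqrt 2 / 4).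
    rewrite (eq_bigr _ (fun v _ => termE v)) big_split /= sumr_const mulr_natr.
    rewrite -mulr_suml -natr_sum -big_mkcond sum1_card /leaves cardsE.
    by congr (_ *+ _ + _).
  have two_leaves : (1 < #|leaves|)%N by apply: acyclic_two_leaves => //; lia.
  apply: (@leif_diff _ _ _ ((#|leaves|%:R - 2)
      * (Num.sqrt 5 / 2 - 3 * Num.sqrt 2 / 4))).
  - by field.
  - by rewrite mulr_ge0 ?(ltW (leaf_bonus_gt0 R)) // subr_ge0 ler_nat.
  - by rewrite mulf_eq0 (gt_eqF (leaf_bonus_gt0 R)) orbF subr_eq0 eqr_nat.
apply: edge_sum_leif => u v uv; rewrite BSO_termE // big_edge //.
by apply: lower_edge_leif => //; apply: edge_degrees_gt2.
Qed.

(** The weights sum to n - q * (number of edges), which equals the bound when the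
    number of edges is n - 1 and is smaller when it is larger. *)
Lemma BSO_upper_leif : (1 < #|T|)%N ->
  BSO T R <= Num.sqrt (1 + (#|T|%:R - 1) ^+ 2)
    ?= iff ([forall u : T, forall v : T, adj u v ==>
        (degree u + degree v == #|T|)%N
          && ((degree u == 1%N) || (degree v == 1%N))] &&
      (#|edges T| == #|T|.-1)).
Proof.
move=> T_gt1; have [connT acycT] := treeT.
have d_gt0 (v : T) : (0 < degree v)%N by apply: degree_gt0.
apply: (leif_trans (x2 :=
    \sum_(E in edges T) \sum_(v in E) upper_weight R #|T| (degree v))).
  apply: edge_sum_leif => u v uv; rewrite BSO_termE // big_edge //.
  by apply: upper_edge_leif => //; apply: acyclic_degreeD.
rewrite handshake.
have termE (v : T) : upper_weight R #|T| (degree v) *+ degree v =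
    1 - upper_defect R #|T| / 2 * (degree v)%:R.
  have dR : (degree v)%:R != 0 :> R by rewrite pnatr_eq0 -lt0n.
  by rewrite /upper_weight -mulr_natr; field.
rewrite (eq_bigr _ (fun v _ => termE v)) sumrB sumr_const -mulr_sumr.
rewrite -natr_sum sum_degree natrM -upper_defectE; last by lia.
have le_m := connected_card_edges connT.
apply: (@leif_diff _ _ _ ((#|edges T|%:R - #|T|.-1%:R) * upper_defect R #|T|)).
- by rewrite -[1 *+ _]/(#|T|%:R); field.
- by rewrite mulr_ge0 ?subr_ge0 ?ler_nat // ltW ?upper_defect_gt0 //; lia.
- rewrite mulf_eq0 [upper_defect _ _ == _]gt_eqF ?upper_defect_gt0 ?orbF //.
    by rewrite subr_eq0 eqr_nat.
  by lia.
Qed.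

End TreeBounds.

Theorem theorem4p1 (R : rcfType) (n : nat) (T : sgraph)
    (treeT : is_tree T) (cardT : #|T| = n) :
  [/\ (3 <= n)%N ->
        Num.sqrt 2 * (n%:R - 3) / 2 + Num.sqrt 5 <= BSO T R,
      BSO T R <= Num.sqrt (1 + (n%:R - 1) ^+ 2),
      (3 <= n)%N ->
        (BSO T R = Num.sqrt 2 * (n%:R - 3) / 2 + Num.sqrt 5 <->
         graph_iso T (path_graph n))
    & (2 <= n)%N ->
        (BSO T R = Num.sqrt (1 + (n%:R - 1) ^+ 2) <->
         graph_iso T (star_graph n))].
Proof.
have [connT acycT] := treeT; rewrite -cardT {n cardT}; split.
- by case/(BSO_lower_leif R treeT).
- have [/(BSO_upper_leif R treeT)[] //|T_le1] := ltnP 1 #|T|.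
  (* A single vertex has no edge. *)
  rewrite /BSO big_pred0 ?sqrtr_ge0 // => E; apply/negP => /edgesP[u [v [uv _]]].
  by have := max_card [set u; v]; rewrite cards2 adj_neq // leqNgt ltnS T_le1.
- move=> T_gt2; have T_gt1 := ltnW T_gt2; rewrite (rwP eqP) eq_sym.
  rewrite (BSO_lower_leif R treeT T_gt2).2; split.
    case/andP=> /eqP two /'forall_'forall_implyP eq_uv.
    apply: tree_path_iso => // v.
    have /card_gt0P[x] : (0 < #|[set v : T | degree v == 1%N]|)%N by rewrite two.
    rewrite inE => /eqP dx.
    (* Degree at most 2 spreads from the leaf x along edges whose degrees are
       equal or add up to 3. *)
    suff : [set w : T | (degree w <= 2)%N] = setT.
      by move/setP/(_ v); rewrite !inE.
    apply: (connected_closed connT (x := x)); first by rewrite inE dx.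
    move=> u w; rewrite !inE => du /eq_uv.
    by have := degree_gt0 connT u T_gt1; lia.
  case: #|T| T_gt2 => [|[|[|m]]] // _ [f bij_f adj_f].
  have deg_f x := iso_degree x bij_f adj_f.
  apply/andP; split.
    rewrite -(card_imset _ (bij_inj bij_f)).
    have -> : f @: [set v | degree v == 1%N] = [set ord0; ord_max].
      have [g fK gK] := bij_f; apply/setP => i; rewrite -[i]gK.
      rewrite (mem_imset _ _ (bij_inj bij_f)) inE -deg_f path_graph_degree !inE.
      by case: ifP.
    by rewrite cards2.
  apply/'forall_'forall_implyP => u v; rewrite -adj_f -!deg_f.
  rewrite !path_graph_degree -!val_eqE /= /path_adj.
  by case: ifP; case: ifP => //=; lia.
- move=> T_gt1; rewrite (rwP eqP) (BSO_upper_leif R treeT T_gt1).2; split.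
    case/andP=> /'forall_'forall_implyP eq_uv _.
    have /card_gt0P[u _] := ltnW T_gt1.
    have /card_gt0P[v] := degree_gt0 connT u T_gt1.
    rewrite inE => /eq_uv duv.
    have [du|dv] : degree u = #|T|.-1 \/ degree v = #|T|.-1 by lia.
      exact: acyclic_star_iso du.
    exact: acyclic_star_iso dv.
  case=> f bij_f adj_f; have deg_f x := iso_degree x bij_f adj_f.
  apply/andP; split.
    apply/'forall_'forall_implyP => u v; rewrite -adj_f -!deg_f.
    case: (f u) (f v) => [i|i] [j|j] //= _;
      rewrite star_degree_center star_degree_leaf ?addn1 ?add1n;
      by rewrite (prednK (ltnW T_gt1)) !eqxx ?orbT.
  have degreeE : (\sum_(x : T) degree x = #|T|.-1 + #|T|.-1)%N.
    under eq_bigr do rewrite -deg_f.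
    rewrite -(reindex f (P := predT) (F := @degree _)) /=; last exact: onW_bij.
    rewrite big_sumType /= big_ord1 star_degree_center.
    under eq_bigr do rewrite star_degree_leaf.
    by rewrite sum1_card card_ord.
  by rewrite -(eqn_pmul2l (m := 2)) // -sum_degree degreeE addnn mul2n.
Qed.
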